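(* Let $r\ge 2$ be a fixed integer, let $Q_d$ be the $d$-dimensional hypercube and let $n=2^d$. Then $\mathcal{D}_r(Q_d,\mathcal{T}_n) = \Theta\left( n/\sqrt{\log n} \right)$ as $d\to\infty$, where the implied constants depend only on $r$.
   Context: $Q_d$ is the graph on vertex set $\{0,1\}^d$ in which two vertices are adjacent iff they differ in exactly one coordinate. Spanning-tree discrepancy: for a connected $n$-vertex graph $G$, an $r$-colouring $f:E(G)\to[r]$ of its edges, and a spanning tree $T$ of $G$ (which has $n-1$ edges), put $D_f(T) := r\cdot\left(\max_{1\le i\le r}|f^{-1}(i)\cap E(T)| - \frac{n-1}{r}\right)$. The $r$-colour spanning-tree discrepancy of $G$ is $\mathcal{D}_r(G,\mathcal{T}_n) := \min_{f:E(G)\to[r]}\ \max_{T} D_f(T)$, where the maximum is over all spanning trees $T$ of $G$. *)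

(* Defs.v *)
From mathcomp Require Import all_boot all_order all_algebra.
From mathcomp Require Import all_classical all_reals all_analysis.

Set Implicit Arguments.
Unset Strict Implicit.
Unset Printing Implicit Defensive.

Import Order.TTheory GRing.Theory Num.Theory.
Import numFieldNormedType.Exports.
Local Open Scope ring_scope.

Record sgraph := SGraph {
  vertex :> finType;
  adj : rel vertex;
  adj_sym : symmetric adj;
  adj_irrefl : irreflexive adj }.

Definition is_edge (G : sgraph) (a : {set G}) : bool :=
  [exists x : G, exists y : G, adj x y && (a == [set x; y]%SET)].

Definition edge (G : sgraph) := {a : {set G} | is_edge a}.

Section SpanningTrees.
Variable G : sgraph.

Definition subadj (A : {set edge G}) : rel G :=
  [rel x y | [exists a in A, val a == [set x; y]%SET]].

Definition connected_rel (h : rel G) : Prop := forall x y : G, connect h x y.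

(* The bound on the size discards the closed walks x, y, x that go back and
   forth along one edge. *)
Definition acyclic_rel (h : rel G) : Prop :=
  forall c : seq G, ucycle h c -> (size c <= 2)%N.

Definition spanning_tree (A : {set edge G}) : Prop :=
  connected_rel (subadj A) /\ acyclic_rel (subadj A).

End SpanningTrees.

Section Discrepancy.
Variables (R : realType) (r : nat) (G : sgraph).
Implicit Types (f : {ffun edge G -> 'I_r}) (A : {set edge G}).

Definition tree_disc f A : R :=
  r%:R * ((\max_(i < r) #|[set a in A | f a == i]%SET|)%N%:R
          - (#|G|%:R - 1) / r%:R).

(* Both sets below are finite, and they are nonempty when G is connected and
   0 < r, so that this sup and this inf are a maximum and a minimum. *)
Definition colouring_disc f : R :=
  sup [set tree_disc f A | A in [set A | spanning_tree A]]%classic.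

Definition spanning_tree_disc : R :=
  inf [set colouring_disc f | f in [set: {ffun edge G -> 'I_r}]]%classic.

End Discrepancy.

Definition cube_adj (d : nat) (x y : {ffun 'I_d -> bool}) : bool :=
  #|[set i | x i != y i]%SET| == 1%N.

Lemma cube_adj_sym d : symmetric (@cube_adj d).
Proof.
move=> x y; congr (_ == _).
by apply: eq_card => i; rewrite !inE eq_sym.
Qed.

Lemma cube_adj_irrefl d : irreflexive (@cube_adj d).
Proof.
move=> x; rewrite /cube_adj eq_card0 // => i.
by rewrite inE eqxx.
Qed.

Definition hypercube (d : nat) : sgraph :=
  SGraph (@cube_adj_sym d) (@cube_adj_irrefl d).

(* Main.v *)
(** A forest restricted to one colour class extends to a spanning tree, so the
    largest number of edges of colour [i] in a spanning tree is the rank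
    [n - c_i], where [c_i] is the number of components of colour class [i].

    Lower bound.  Writing [c_i] as the sum over the vertices [x] of [1 / |C_i(x)|],
    with [C_i(x)] the component of [x], the ranks add up to the sum over [x] and
    [i] of [1 - 1 / |C_i(x)|].  Some colour has degree at least [d / r] at [x] and
    contributes [1 - O(1/d)], and a vertex meeting two colours gains another
    [1/2].  Hence if the discrepancy is small, then few vertices meet two colours,
    and no colour owns much more than [n / r] vertices.  But the vertices meeting
    two colours separate the sets owned by the single colours, while a subset of
    the cube of size between [c n] and [(1 - c) n] has a vertex boundary of order
    [n / sqrt d].  This follows from a one-sided inequality of Talagrand type,
    [sum_(x in A) sqrt h_A(x) >= |A| (n - |A|) / (2 n)], where [h_A(x)] is the
    number of neighbours of [x] outside [A]; it is proved by induction on the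
    dimension.

    Upper bound.  Cut the levels of the cube into [r] intervals of about [n / r]
    vertices and colour an edge by the interval of its lower end.  Colour [i] then
    touches at most [n / r] vertices plus two levels, i.e. [O(n / sqrt d)] more. *)
Require Import Defs.
From mathcomp Require Import all_boot all_order all_algebra.
From mathcomp Require Import all_classical all_reals all_analysis.
From mathcomp Require Import zify ring lra.
Import Order.TTheory GRing.Theory Num.Theory.
Import numFieldNormedType.Exports.
Local Open Scope ring_scope.
Local Open Scope classical_set_scope.

(** * Components, bridges and forests in a finite graph *)

Section Forests.
Import boot.fintype boot.fingraph boot.finset.
Local Open Scope nat_scope.
Local Open Scope set_scope.
Variable G : sgraph.
Implicit Types (A B F : {set edge G}) (e : edge G) (u v x y : G).

Lemma edgeP e : exists u v, adj u v /\ val e = [set u; v].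
Proof.
case: e => a /= /existsP[u /existsP[v /andP[uv /eqP ->]]].
by exists u, v.
Qed.

Lemma edge_neq e u v : val e = [set u; v] -> u != v.
Proof.
have [x [y [xy ->]]] := edgeP e; apply: contra_eqN => /eqP ->.
have xDy : x != y by apply: contraTneq xy => ->; rewrite adj_irrefl.
apply/eqP => /(congr1 (fun s : {set G} => #|s|)).
by rewrite cards2 xDy setUid cards1.
Qed.

Lemma edge_other e u v y : val e = [set u; v] -> val e = [set u; y] -> v = y.
Proof.
move=> euv euy; have := set22 u v; rewrite -euv euy.
by case/set2P => // vu; have := edge_neq _ _ _ euv; rewrite vu eqxx.
Qed.

Lemma subadjP A x y :
  reflect (exists2 e, e \in A & val e = [set x; y]) (subadj A x y).
Proof.
by apply: (iffP existsP) => [[e /andP[eA /eqP exy]]|[e eA exy]]; exists e;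
  rewrite ?eA ?exy ?eqxx.
Qed.

Lemma subadj_sym A : symmetric (subadj A).
Proof. by move=> x y; apply: eq_existsb => e; rewrite setUC. Qed.

Lemma subadj_csym A : connect_sym (subadj A).
Proof. exact/sym_connect_sym/subadj_sym. Qed.

Lemma subadjS A B : A \subset B -> subrel (subadj A) (subadj B).
Proof.
move=> AB x y /subadjP[e eA exy]; apply/subadjP.
by exists e => //; apply: (subsetP AB).
Qed.

Lemma connectS A B : A \subset B ->
  subrel (connect (subadj A)) (connect (subadj B)).
Proof.
by move=> AB; apply: connect_sub => x y /(subadjS _ _ AB); apply: connect1.
Qed.

Lemma subadjD1 A e x y : subadj A x y ->
  subadj (A :\ e) x y \/ val e = [set x; y].
Proof.
case/subadjP => e' e'A e'xy; have [<-|ne] := eqVneq e' e; [by right|left].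
by apply/subadjP; exists e' => //; rewrite !inE ne.
Qed.

Definition comps A := n_comp (subadj A) predT.

(** The set [a] of vertices joined to [u] or [v] without [e] is closed under both relations. Inside
    [a] there is one component with [e], and one or two without it; outside [a] nothing changes. *)
Lemma comps_D1 A e u v : e \in A -> val e = [set u; v] ->
  comps (A :\ e) = comps A + ~~ connect (subadj (A :\ e)) u v.
Proof.
move=> eA euv; set h' := subadj (A :\ e); set h := subadj A.
have symh' : connect_sym h' := subadj_csym _.
have symh : connect_sym h := subadj_csym _.
have h'h : subrel h' h by apply/subadjS/subD1set.
have ch'h : subrel (connect h') (connect h) by apply/connectS/subD1set.
pose a : pred G := closure h' (pred2 u v).
have clh' : closed h' a by apply: closure_closed.
have ua : u \in a by apply: mem_closure; rewrite !inE eqxx.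
have va : v \in a by apply: mem_closure; rewrite !inE eqxx orbT.
have hcase x y : h x y -> h' x y \/ (x \in a) && (y \in a).
  move=> /(subadjD1 _ e)[|exy]; [by left|right].
  have := set21 x y; have := set22 x y; rewrite -exy euv.
  by do 2![case/set2P => ->]; rewrite ?ua ?va.
have clh : closed h a.
  apply: intro_closed => // x y /hcase[/clh'->//|/andP[]//].
have huv : connect h u v by apply/connect1/subadjP; exists e.
have na : n_comp h a = 1.
  have -> : n_comp h a = n_comp h (closure h (pred2 u v)).
    apply: eq_n_comp_r => x; apply/idP/idP.
      by case/existsP => t /andP[xt tuv]; apply/existsP; exists t;
         apply/andP; split=> //=; apply: ch'h.
    case/existsP => t /andP[/= xt tuv].
    by rewrite (closed_connect clh xt); case/pred2P: tuv => ->.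
  by rewrite n_comp_closure2 // huv.
have na' : n_comp h [predC a] = n_comp h' [predC a].
  apply: eq_card => x; rewrite !inE /=.
  have [xa|xa] := boolP (x \in a); first by rewrite !andbF.
  rewrite !andbT /roots /root; congr (odflt _ _ == _).
  apply: eq_pick => y; apply/idP/idP; last exact: ch'h.
  move=> hxy; have cl : closed h (connect h' x).
    apply: intro_closed => // y1 z1 /hcase[h1 c1|/andP[ya _] c1].
      by apply: connect_trans c1 (connect1 h1).
    by rewrite (closed_connect clh' c1) ya in xa.
  by have := closed_connect cl hxy; rewrite -!topredE /= connect0 => <-.
rewrite /comps (n_compC a h) (n_compC a h') na na' [n_comp h' a]n_comp_closure2 //.
by rewrite addSn add1n addSn addnC.
Qed.

(** Counting components avoids naming the ends of [e]; [bridgeE] gives the usual form. *)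
Definition bridge A e := comps A < comps (A :\ e).

Lemma bridgeE A e u v : e \in A -> val e = [set u; v] ->
  bridge A e = ~~ connect (subadj (A :\ e)) u v.
Proof.
move=> eA euv; rewrite /bridge (comps_D1 _ _ _ _ eA euv).
by case: (connect _ _ _); rewrite /= ?addn0 ?addn1 ?ltnn ?ltnSn.
Qed.

Lemma comps_bridge A e : e \in A -> comps (A :\ e) = comps A + bridge A e.
Proof.
move=> eA; have [u [v [_ euv]]] := edgeP e.
by rewrite (bridgeE _ _ _ _ eA euv) (comps_D1 _ _ _ _ eA euv).
Qed.

Lemma bridgeS A B e : A \subset B -> e \in A -> bridge B e -> bridge A e.
Proof.
move=> AB eA; have [u [v [_ euv]]] := edgeP e.
rewrite (bridgeE _ _ _ _ eA euv) (bridgeE _ _ _ _ (subsetP AB _ eA) euv).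
by apply: contra; apply/connectS/setSD.
Qed.

(** Delete the edges outside [F] one at a time: a bridge stays a bridge in a smaller edge set, so
    each deletion creates one component. *)
Lemma compsD A F : F \subset A -> {in A :\: F, forall e, bridge A e} ->
  comps F = comps A + #|A :\: F|.
Proof.
elim: {A}_.+1 {-2}A (ltnSn #|A :\: F|) => // n IHn A ltn FA br.
have [/eqP AF0|[e eAF]] := set_0Vmem (A :\: F).
  have -> : A = F by apply/eqP; rewrite eqEsubset -setD_eq0 AF0.
  by rewrite setDv cards0 addn0.
have /setDP[eA eF] := eAF.
have AFD : (A :\ e) :\: F = (A :\: F) :\ e by rewrite setDDl setUC -setDDl.
rewrite (cardsD1 e) eAF in ltn *.
rewrite (IHn (A :\ e)) ?AFD //.
- by rewrite comps_bridge // br // -addnA.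
- by rewrite subsetD1 FA.
- move=> e' /setD1P[ne e'AF]; apply: (bridgeS _ A); rewrite ?subD1set ?br //.
  by rewrite !inE ne; case/setDP: e'AF.
Qed.

Lemma comps_set0 : comps set0 = #|G|.
Proof.
apply: eq_card => x; rewrite !inE andbT; apply/eqP.
have /connectP[[//|y p]] := connect_root (subadj set0) x.
by case/andP => /subadjP[e]; rewrite inE.
Qed.

Lemma leq_card_comps A : #|G| <= #|A| + comps A.
Proof.
elim: {A}_.+1 {-2}A (ltnSn #|A|) => // n IHn A ltn.
have [->|[e eA]] := set_0Vmem A; first by rewrite comps_set0 leq_addl.
rewrite (cardsD1 e) eA in ltn *.
apply: leq_trans (IHn _ ltn) _; rewrite comps_bridge //.
by rewrite addnA add1n addSn -addn1 leq_add2l leq_b1.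
Qed.

(** A simple path that joins the ends of [e] and avoids [e] closes up to a cycle; conversely, the
    rest of a cycle joins the ends of its closing edge. *)
Lemma acyclic_bridge A : acyclic_rel (subadj A) <-> {in A, forall e, bridge A e}.
Proof.
split=> [acA e eA | br c /andP[]].
  have [u [v [_ euv]]] := edgeP e; rewrite (bridgeE _ _ _ _ eA euv).
  apply/negP => /connectP[p0 /shortenP[p hp up _ {p0}]] lp.
  have /acA : ucycle (subadj A) (u :: p).
    rewrite /ucycle up andbT /= rcons_path -lp subadj_sym; apply/andP; split.
      by apply: sub_path hp; apply/subadjS/subD1set.
    by apply/subadjP; exists e.
  (* The cycle could only have at most two vertices. One vertex gives [u = v]; with two, the path is
     the single edge [e], which was deleted. *)
  have := edge_neq _ _ _ euv; case: p hp lp {up} => [_ ->|w [|//]] /=.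
    by rewrite eqxx.
  rewrite andbT => /subadjP[e' /setD1P[/eqP ne _] e'uw] vw; case: ne.
  by apply: val_inj; rewrite e'uw euv vw.
case: c => [//|u [//|y [//|z q]]].
set p := y :: z :: q; rewrite /= rcons_path /= => /and4P[uy yz zq lu] /and4P[].
rewrite inE negb_or => /andP[yu up] yp zp uq.
set v := last z q; have {lu} /subadjP[e eA] : subadj A u v by rewrite subadj_sym.
move=> euv; have := br _ eA; rewrite (bridgeE _ _ _ _ eA euv) => /negP[].
have yv : y != v by apply: contraNneq yp => ->; apply: mem_last.
have uDy : subadj (A :\ e) u y.
  case: (subadjD1 _ e _ _ uy) => // euy; case/eqP: yv.
  by rewrite (edge_other _ _ _ _ euv euy).
apply: connect_trans (connect1 uDy) _; apply/connectP; exists (z :: q) => //.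
(* The rest of the cycle never returns to [u], so none of its steps is [e]. *)
apply: (@sub_in_path _ (predC1 u) (subadj A)); last by rewrite /= yz.
  move=> a b; rewrite !inE => au bu /(subadjD1 _ e)[//|eab].
  have := set21 u v; rewrite -euv eab => /set2P[] ub.
    by rewrite ub eqxx in au.
  by rewrite ub eqxx in bu.
apply/allP => w; rewrite !inE; apply: contraTneq => ->.
by rewrite (negPf yu) /= -in_cons (negPf up).
Qed.

(** Take [A] of least size between [F] and [B] with as many components as [B]: an edge outside [F]
    that is not a bridge could still be dropped. *)
Lemma exists_basis F B : F \subset B -> exists A,
  [/\ F \subset A, A \subset B, comps A = comps B &
      comps F = comps A + #|A :\: F| ].
Proof.
move=> FB.
pose P (A : {set edge G}) := [&& F \subset A, A \subset B & comps A == comps B].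
have PB : P B by rewrite /P FB subxx eqxx.
case: (arg_minnP (fun A : {set edge G} => #|A|) PB) => A /and3P[FA AB /eqP cAB] minA.
exists A; split=> //; apply: compsD => // e /setDP[eA eF].
apply: contraT => nbr; have := minA (A :\ e); rewrite /P subsetD1 FA eF /=.
rewrite (subset_trans (subD1set _ _) AB) comps_bridge // (negPf nbr) addn0 cAB.
by rewrite eqxx (cardsD1 e A) eA ltnn => /(_ isT).
Qed.

(** A maximal forest [F] of [B] has [#|G| - comps B] edges, and it extends to a basis [A] of the
    whole edge set, which is the tree. *)
Lemma exists_spanning_tree B : connected_rel (@adj G) ->
  exists2 A, spanning_tree A & #|G| <= #|A :&: B| + comps B.
Proof.
move=> cG; have [F [_ FB cFB c0F]] := exists_basis _ _ (sub0set B).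
have [A [FA _ cA cFA]] := exists_basis _ _ (subsetT F).
have cardA : #|A| + comps A = #|G|.
  by rewrite -comps_set0 c0F cFA -(cardsID F A) setD0 (setIidPr FA) addnC addnA addnAC.
exists A; last first.
  rewrite -comps_set0 c0F cFB setD0 addnC leq_add2r; apply: subset_leq_card.
  by rewrite subsetI FA.
have cT x y : connect (subadj (setT : {set edge G})) x y.
  apply: connect_sub (cG x y) => {}x {}y xy; apply/connect1/subadjP.
  have xyP : is_edge [set x; y].
    by apply/existsP; exists x; apply/existsP; exists y; rewrite xy eqxx.
  by exists (exist (fun a : {set G} => is_edge a) _ xyP : edge G); rewrite ?inE.
split=> [x y|].
  rewrite -(root_connect (subadj_csym A)); apply/eqP.
  have /card_le1_eqP : comps A <= 1.
    rewrite cA; apply/card_le1_eqP => a b; rewrite !inE !andbT => /eqP <- /eqP <-.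
    by apply/(rootP (subadj_csym _)).
  by apply; rewrite !inE andbT roots_root //; apply: subadj_csym.
(* Deleting an edge that is not a bridge would leave too few edges for the number of components,
   against [leq_card_comps]. *)
apply/acyclic_bridge => e eA; apply: contraT => nbr.
have := leq_card_comps (A :\ e).
rewrite comps_bridge // (negPf nbr) -cardA (cardsD1 e A) eA addn0.
by rewrite leq_add2r ltnn.
Qed.

(** [F] has [#|G| - #|F|] components, and every vertex outside [W] is isolated, hence a component by
    itself. *)
Lemma card_forest_endpoints A F (W : {set G}) : acyclic_rel (subadj A) ->
  F \subset A -> {in F, forall e, val e \subset W} -> #|F| <= #|W|.
Proof.
move=> /acyclic_bridge br FA FW.
have h : #|G| = comps F + #|F|.
  rewrite -comps_set0 (compsD F set0) ?setD0 ?sub0set // => e eF.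
  by apply: (bridgeS _ _ _ FA eF); apply: br; apply: (subsetP FA).
have : #|~: W| <= comps F.
  apply: subset_leq_card; apply/subsetP => x; rewrite !inE andbT => xW.
  have /connectP[[|y p] /=] := connect_root (subadj F) x; first by move=> _ /eqP.
  case/andP => /subadjP[e eF exy] _ _; case/negP: xW.
  by apply: (subsetP (FW _ eF)); rewrite exy set21.
move=> hW; rewrite -(leq_add2l (comps F)) -h -(cardsC W) addnC leq_add2r //.
Qed.

Section RealCount.
Variable R : numFieldType.
Local Open Scope ring_scope.

(** A component with [c] vertices contributes [c] terms [1 / c]. This turns a global count into a
    sum of local terms. *)
Lemma compsE A :
  (comps A)%:R = \sum_(x : G) (#|connect (subadj A) x|%:R)^-1 :> R.
Proof.
have sy := subadj_csym A.
rewrite (partition_big (root (subadj A)) (roots (subadj A))) /=; last first.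
  by move=> x _; apply: roots_root.
rewrite /comps /n_comp_mem -sum1_card natr_sum.
apply: eq_big => [x|x]; first by rewrite !inE andbT.
rewrite !inE andbT => /eqP rx; under eq_bigr => y /eqP ry.
  have cxy : connect (subadj A) x y by rewrite sy -ry connect_root.
  rewrite -(eq_card (same_connect sy cxy)); over.
rewrite sumr_const; have -> : #|[pred y | root (subadj A) y == x]| =
    #|connect (subadj A) x|.
  by apply: eq_card => y; rewrite !inE -[X in _ == X]rx root_connect // sy.
rewrite -[RHS]mulr_natl divff // pnatr_eq0 -lt0n; apply/card_gt0P; exists x.
exact: connect0.
Qed.

End RealCount.

End Forests.

(** * The isoperimetric inequality of Talagrand type in the cube *)

Section CubeIsoperimetry.
Import boot.fintype boot.finset.
Variable d : nat.
Notation V := {ffun 'I_d -> bool}.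
Implicit Types (x y : V) (i : 'I_d) (A : {set V}).

Definition flip i x : V := [ffun j => x j (+) (j == i)].

Lemma flipK i : involutive (flip i).
Proof. by move=> x; apply/ffunP => j; rewrite !ffunE addbK. Qed.

(** The subcube through [x] in which the first [k] coordinates are free. The induction on dimension
    runs over these subcubes, inside one fixed vertex type. *)
Definition agree k x y := [forall i : 'I_d, (k <= i)%N ==> (x i == y i)].

Lemma agreeP k x y :
  reflect (forall i, (k <= i)%N -> x i = y i) (agree k x y).
Proof.
by apply: (iffP forallP) => h i; [move=> ki; apply/eqP/(implyP (h i))
                                 |apply/implyP => /h ->].
Qed.

Lemma agree0 x y : agree 0 x y = (y == x).
Proof.
apply/agreeP/eqP => [h|-> //]; apply/ffunP => i; exact/esym/h.
Qed.

Lemma agree_full x y : agree d x y.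
Proof. by apply/agreeP => i; rewrite leqNgt ltn_ord. Qed.

Lemma agree_flip k i x y : agree k (flip i x) (flip i y) = agree k x y.
Proof.
by apply: eq_forallb => j; rewrite !ffunE (inj_eq (can_inj (addbK _))).
Qed.

Lemma agreeS i x y : agree i x y = agree i.+1 x y && (y i == x i).
Proof.
apply/agreeP/andP => [h|[/agreeP h /eqP e] j]; last first.
  by rewrite leq_eqVlt => /predU1P[/val_inj <-//|]; apply: h.
by split; [apply/agreeP => j /ltnW; apply: h | rewrite h].
Qed.

Lemma agreeS_flip i x y :
  agree i (flip i x) y = agree i.+1 x y && (y i != x i).
Proof.
rewrite agreeS ffunE eqxx addbT; congr (_ && _); last first.
  by case: (y i) (x i) => [] [].
apply/agreeP/agreeP => h j ij; have := h j ij;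
  by rewrite ffunE -val_eqE (gtn_eqF ij) addbF.
Qed.

Variable R : rcfType.
Implicit Type g : V -> R.

Definition subcube_sum k g x := \sum_(y | agree k x y) g y.

Lemma subcube_sum0 g x : subcube_sum 0 g x = g x.
Proof. by rewrite /subcube_sum (eq_bigl _ _ (agree0 x)) big_pred1_eq. Qed.

Lemma subcube_sumS i g x :
  subcube_sum i.+1 g x = subcube_sum i g x + subcube_sum i g (flip i x).
Proof.
rewrite /subcube_sum (bigID (fun y => y i == x i)) /=; congr (_ + _);
  apply: eq_bigl => y; [exact/esym/agreeS | exact/esym/agreeS_flip].
Qed.

Lemma subcube_sum_flip k i g x :
  subcube_sum k (g \o flip i) x = subcube_sum k g (flip i x).
Proof.
rewrite /subcube_sum [RHS](reindex_inj (can_inj (flipK i))) /=.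
by apply: eq_bigl => y; rewrite agree_flip.
Qed.

Lemma subcube_sum1 k x : (k <= d)%N -> subcube_sum k (fun=> 1) x = 2 ^+ k.
Proof.
elim: k x => [|k IHk] x kd; first by rewrite subcube_sum0.
by rewrite (subcube_sumS (Ordinal kd)) !IHk ?(ltnW kd) // exprS mulr_natl mulr2n.
Qed.

Definition out_degree k A x := #|[set i : 'I_d | (i < k)%N && (flip i x \notin A)]|.

Lemma out_degreeS i A x :
  out_degree i.+1 A x = (out_degree i A x + (flip i x \notin A))%N.
Proof.
rewrite /out_degree (cardsD1 i) inE ltnSn addnC; congr (_ + _)%N.
apply: eq_card => j; rewrite !inE ltnS [(j <= i)%N]leq_eqVlt.
have [->|] := eqVneq j i; first by rewrite ltnn.
by move=> ji; rewrite (inj_eq val_inj) (negPf ji).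
Qed.

(* This is [sqrt (h + 1) >= p sqrt h + q] for a point [(p, q)] of the unit disc;
   taking [q = t] and [p = 1 - t ^+ 2] avoids a square root in [p]. *)
Lemma sqrt_succ_ge (h : nat) (t : R) : 0 <= t <= 1 ->
  (1 - t ^+ 2) * Num.sqrt h%:R + t <= Num.sqrt h.+1%:R.
Proof.
move=> /andP[t0 t1]; set s := Num.sqrt h%:R.
have s0 : 0 <= s by apply: sqrtr_ge0.
have hs : h%:R = s ^+ 2 by rewrite sqr_sqrtr.
have t2 : 0 <= 1 - t ^+ 2 by rewrite subr_ge0 expr_le1.
have l0 : 0 <= (1 - t ^+ 2) * s + t by rewrite addr_ge0 // mulr_ge0.
rewrite -(ger0_norm l0) -sqrtr_sqr ler_sqrt // -natr1 hs -subr_ge0.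
have -> : s ^+ 2 + 1 - ((1 - t ^+ 2) * s + t) ^+ 2 =
    (1 - t ^+ 2) * (t * s - 1) ^+ 2 + (t * s) ^+ 2 by ring.
by apply: addr_ge0; [apply: mulr_ge0|]; rewrite ?sqr_ge0.
Qed.

(** Joining the two halves raises the target by [N * t ^+ 2], while [t * (a0 - a1)] supplies
    [2 * N * t ^+ 2]. The surplus pays for the factor [1 - t ^+ 2], whose cost on the lower bound
    for [S0] is [t ^+ 2 * a0 * (N - a0) / (2 * N)]. *)
Lemma two_point (N a0 a1 S0 S1 : R) (t := (a0 - a1) / (2 * N)) :
  0 < N -> 0 <= a1 -> a1 <= a0 -> a0 <= N ->
  a0 * (N - a0) / (2 * N) <= S0 -> a1 * (N - a1) / (2 * N) <= S1 ->
  (a0 + a1) * (2 * N - (a0 + a1)) / (2 * (2 * N)) <=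
    (1 - t ^+ 2) * S0 + t * (a0 - a1) + S1.
Proof.
move=> N0 a10 a01 aN h0 h1.
have t0 : 0 <= t by rewrite divr_ge0 ?subr_ge0 // mulr_ge0 // ltW.
have t1 : t <= 1 by rewrite ler_pdivrMr ?mulr_gt0 // mul1r; lra.
have t2 : 0 <= 1 - t ^+ 2 by rewrite subr_ge0 expr_le1.
apply: le_trans (lerD (lerD (ler_wpM2l t2 h0) (lexx _)) h1).
rewrite -subr_ge0.
have -> : (1 - t ^+ 2) * (a0 * (N - a0) / (2 * N)) + t * (a0 - a1) +
    a1 * (N - a1) / (2 * N) - (a0 + a1) * (2 * N - (a0 + a1)) / (2 * (2 * N)) =
    t ^+ 2 * (N - a0 * (N - a0) / (2 * N)) by rewrite /t; field; rewrite ?gt_eqF.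
apply: mulr_ge0; rewrite ?sqr_ge0 // subr_ge0 ler_pdivrMr ?mulr_gt0 // -subr_ge0.
have -> : N * (2 * N) - a0 * (N - a0) = N * N + N * (N - a0) + a0 ^+ 2 by ring.
by rewrite !addr_ge0 ?sqr_ge0 // mulr_ge0 ?subr_ge0 // ltW.
Qed.

Definition ind A x : R := (x \in A)%:R.

(** Split along coordinate [k]. In the denser half each point of [A] whose flip lies outside [A]
    gains an outgoing edge, used through [sqrt_succ_ge]; the other half keeps at least its old
    sum. *)
Lemma subcube_isoperimetry k A x (a := subcube_sum k (ind A) x) : (k <= d)%N ->
  a * (2 ^+ k - a) / (2 * 2 ^+ k) <=
  subcube_sum k (fun y => ind A y * Num.sqrt (out_degree k A y)%:R) x.
Proof.
rewrite {}/a; elim: k x => [|k IHk] x kd.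
  rewrite !subcube_sum0 /ind; case: (x \in A); rewrite ?mul0r // subrr mulr0 mul0r.
  by rewrite mulr_ge0 ?sqrtr_ge0.
have {}IHk y := IHk y (ltnW kd); pose i : 'I_d := Ordinal kd.
have Efl g y : subcube_sum k.+1 g (flip i y) = subcube_sum k.+1 g y.
  by rewrite !(subcube_sumS i) flipK addrC.
(* Both sides are invariant under flipping [x] in direction [i], so [x] may be put in the denser
   half. *)
wlog le10 : x / subcube_sum k (ind A) (flip i x) <= subcube_sum k (ind A) x.
  move=> W; have [/W //|/ltW le01] := leP (subcube_sum k (ind A) (flip i x))
    (subcube_sum k (ind A) x).
  by have := W (flip i x); rewrite flipK !Efl => /(_ le01).
have := IHk (flip i x); have := IHk x.
set S0 := subcube_sum k _ x; set S1 := subcube_sum k _ (flip i x).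
rewrite [in X in _ -> _ -> X <= _]exprS [in X in _ -> _ -> X <= _](subcube_sumS i) /=.
move: le10; set a0 := subcube_sum k (ind A) x.
set a1 := subcube_sum k (ind A) (flip i x) => le10 h0 h1.
set N := 2 ^+ k in h0 h1 *.
have N0 : 0 < N by rewrite exprn_gt0.
have ind01 y : 0 <= ind A y <= 1 by rewrite /ind; case: (_ \in _); rewrite ?lexx ?ler01.
have a10 : 0 <= a1 by apply: sumr_ge0 => y _; case/andP: (ind01 y).
have a0N : a0 <= N.
  rewrite -[N](subcube_sum1 k x (ltnW kd)).
  by apply: ler_sum => y _; case/andP: (ind01 y).
apply: le_trans (two_point _ _ _ _ _ N0 a10 le10 a0N h0 h1) _.
set t := _ / (2 * N).
have t0 : 0 <= t by rewrite divr_ge0 ?subr_ge0 // mulr_ge0 // ltW.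
have t1 : t <= 1 by rewrite ler_pdivrMr ?mulr_gt0 // mul1r; lra.
rewrite (subcube_sumS i) /=; apply: lerD; last first.
  apply: ler_sum => y _; apply: ler_wpM2l; first by case/andP: (ind01 y).
  by rewrite ler_sqrt // ler_nat (out_degreeS i) leq_addr.
(* As a sum over the denser half, the gain can be checked point by point; a point outside [A]
   contributes at most zero to it. *)
have -> : a0 - a1 = subcube_sum k (fun y => ind A y - ind A (flip i y)) x.
  by rewrite /a1 -subcube_sum_flip /subcube_sum sumrB.
rewrite !mulr_sumr -big_split /=; apply: ler_sum => y _.
rewrite (out_degreeS i) /ind; case: (y \in A); last first.
  by rewrite !mul0r mulr0 add0r sub0r mulrN oppr_le0 mulr_ge0.
rewrite !mul1r; case: (flip i y \in A) => /=.
  rewrite subrr mulr0 addr0 addn0 ler_piMl ?sqrtr_ge0 //.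
  by rewrite gerBl sqr_ge0.
by rewrite subr0 mulr1 addn1 sqrt_succ_ge // t0.
Qed.

Lemma cube_isoperimetry A :
  #|A|%:R * (2 ^+ d - #|A|%:R) / (2 * 2 ^+ d) <=
  \sum_(x in A) Num.sqrt (out_degree d A x)%:R :> R.
Proof.
have sT g x : subcube_sum d g x = \sum_y g y.
  by apply: eq_bigl => y; rewrite agree_full.
have := subcube_isoperimetry d A [ffun=> false] (leqnn d); rewrite !sT.
have -> : \sum_y ind A y = #|A|%:R.
  by rewrite -sum1_card natr_sum [RHS]big_mkcond; apply: eq_bigr => y _;
    rewrite /ind; case: ifP.
move=> h; apply: le_trans h _; rewrite le_eqVlt; apply/orP; left; apply/eqP.
rewrite [RHS]big_mkcond; apply: eq_bigr => y _.
by rewrite /ind; case: ifP; rewrite ?mul1r ?mul0r.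
Qed.

End CubeIsoperimetry.

(** * Binomial coefficients are at most [2 ^ d / sqrt d] *)

Section Binomial.
Local Open Scope nat_scope.

Lemma bin_central m : 'C(m.*2.+2, m.+1) * m.+1 = 2 * m.*2.+1 * 'C(m.*2, m).
Proof.
have h1 := mul_bin_diag m.*2.+2 m; have h2 := mul_bin_diag m.*2.+1 m.
have h3 : 'C(m.*2.+1, m.+1) = 'C(m.*2.+1, m).
  by rewrite -bin_sub ?ltnS -?addnn ?leq_addl // subSS addnK.
move: h1 h2; rewrite /= h3; set b := 'C(_, _); set c := 'C(_, _).
by set e := 'C(_, _) => h1 h2; lia.
Qed.

(** By [bin_central] the induction step reduces to [(2m + 1)(2m + 3) <= (2m + 2)^2]. *)
Lemma bin_central_sqr m : 'C(m.*2, m) ^ 2 * m.*2.+1 <= 16 ^ m.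
Proof.
elim: m => // m IHm; rewrite -(leq_pmul2r (ltn0Sn m)) -(leq_pmul2r (ltn0Sn m)).
rewrite doubleS; have := bin_central m.
move: IHm; set b := 'C(_, m); set c := 'C(_, m.+1) => IHm cb.
have -> : c ^ 2 * m.*2.+3 * m.+1 * m.+1 = (c * m.+1) ^ 2 * m.*2.+3 by lia.
rewrite cb; have -> : 16 ^ m.+1 * m.+1 * m.+1 = 16 ^ m * (16 * m.+1 * m.+1).
  by rewrite expnS; lia.
have -> : (2 * m.*2.+1 * b) ^ 2 * m.*2.+3 =
   (b ^ 2 * m.*2.+1) * (4 * m.*2.+1 * m.*2.+3) by lia.
by apply: leq_mul => //; lia.
Qed.

Lemma bin_le_central m k : 'C(m.*2, k) <= 'C(m.*2, m).
Proof.
wlog km : k / k <= m => [W|].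
  case: (leqP k m) => [/W //|mk]; case: (leqP k m.*2) => [k2|k2]; last first.
    by rewrite bin_small.
  by rewrite -bin_sub //; apply: W; lia.
move: km; have [t] := ubnP (m - k); elim: t k => // t IHt k mk km.
have [->//|ltkm] := eqVneq k m; apply: leq_trans (IHt k.+1 _ _); try lia.
rewrite -(leq_pmul2l (ltn0Sn k)) mul_bin_left leq_mul2r; lia.
Qed.

Lemma bin_sqr_le d k : 'C(d, k) ^ 2 * d <= 4 ^ d.
Proof.
have E16 m : 16 ^ m = 4 ^ m.*2 by rewrite -muln2 mulnC expnM.
rewrite -(odd_double_half d); set m := d./2; case: (odd d); last first.
  rewrite /= add0n -(E16 m); apply: leq_trans (bin_central_sqr m).
  by rewrite leq_mul ?leq_exp2r ?bin_le_central.
rewrite /= add1n [4 ^ _.+1]expnS -(E16 m); have := bin_central_sqr m.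
(* For odd [d], Pascal's rule costs a factor 2, whose square is the extra factor of [4 ^ d]. *)
have : 'C(m.*2.+1, k) <= 2 * 'C(m.*2, m).
  case: k => [|k]; first by rewrite bin0 muln_gt0 bin_gt0 -addnn leq_addr.
  by rewrite binS mul2n -[X in _ <= X]addnn leq_add ?bin_le_central.
rewrite -(leq_exp2r _ _ (isT : 0 < 2)) expnMn => h1 h2.
by apply: leq_trans (leq_mul h1 (leqnn _)) _; rewrite -mulnA leq_mul.
Qed.

Lemma bin_sqrt_le (R : rcfType) d k :
  ('C(d, k)%:R * Num.sqrt d%:R <= 2 ^+ d :> R)%R.
Proof.
rewrite -(@ler_pXn2r _ 2%N) ?nnegrE ?mulr_ge0 ?sqrtr_ge0 ?exprn_ge0 //.
rewrite exprMn sqr_sqrtr // exprAC -!natrX -natrM ler_nat.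
exact: bin_sqr_le.
Qed.

End Binomial.

(** * Levels of the cube and the colouring by bands *)

Section CubeGraph.
Import boot.fintype boot.fingraph boot.finset.
Variable d : nat.
Notation V := {ffun 'I_d -> bool}.
Notation Q := (hypercube d).
Implicit Types (x y : V).

Lemma cube_adjP x y : reflect (exists i, y = flip d i x) (cube_adj x y).
Proof.
apply: (iffP cards1P) => [[i xy]|[i ->]]; exists i.
  apply/ffunP => j; have := in_set1 j i; rewrite -xy inE ffunE => <-.
  by case: (x j) (y j) => [] [].
apply/setP => j; rewrite !inE ffunE.
by case: (x j) (j == i) => [] [].
Qed.

Lemma cube_adj_flip i x : cube_adj x (flip d i x).
Proof. by apply/cube_adjP; exists i. Qed.

Lemma card_cube : #|Q| = (2 ^ d)%N.
Proof. by rewrite card_ffun card_bool card_ord. Qed.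

Lemma cube_connected : connected_rel (@adj Q).
Proof.
suff h k x y : (k <= d)%N -> agree d k x y -> connect (@adj Q) x y.
  by move=> x y; apply: (h d) => //; apply: agree_full.
elim: k x => [|k IHk] x kd; first by rewrite agree0 => /eqP ->.
move=> xy; pose i : 'I_d := Ordinal kd; have [yx|yx] := eqVneq (y i) (x i).
  by apply: IHk (ltnW kd) _; rewrite (agreeS d i) xy yx /=.
apply: (@connect_trans _ _ (flip d i x)).
  by apply/connect1/cube_adj_flip.
by apply: IHk (ltnW kd) _; rewrite (agreeS_flip d i) xy yx.
Qed.

Definition level x := #|[set i | x i]|.

Lemma level_flip i x : ~~ x i -> level (flip d i x) = (level x).+1.
Proof.
move=> xi; rewrite /level (cardsD1 i) inE ffunE eqxx (negPf xi) add1n.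
congr _.+1; apply: eq_card => j; rewrite !inE ffunE.
by have [->|_] := eqVneq j i; rewrite ?addbF //= (negPf xi).
Qed.

Lemma edge_level (e : edge Q) :
  exists x y : V, val e = [set x; y] /\ level y = (level x).+1.
Proof.
have [x [_ [/cube_adjP[i ->] ->]]] := edgeP Q e.
have [xi|xi] := boolP (x i); last by exists x, (flip d i x); rewrite level_flip.
exists (flip d i x), x; rewrite setUC; split=> //.
by rewrite -{1}(flipK d i x) level_flip // ffunE eqxx xi.
Qed.

Lemma card_layer k : (#|[set x | level x == k]| <= 'C(d, k))%N.
Proof.
rewrite -[in 'C(d, k)](card_ord d) -card_draws.
rewrite -(card_in_imset (f := fun x : V => [set i | x i])) => [|x y _ _ /setP xy].
  by apply: subset_leq_card; apply/subsetP => _ /imsetP[x + ->]; rewrite !inE.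
by apply/ffunP => i; have := xy i; rewrite !inE.
Qed.

Lemma level_max x : (level x <= d)%N.
Proof. by rewrite -[d in (_ <= d)%N]card_ord max_card. Qed.

Definition below k := #|[set x | level x < k]%N|.

Lemma belowS k : below k.+1 = (below k + #|[set x | level x == k]|)%N.
Proof.
have kk0 : [set x | level x < k]%N :&: [set x | level x == k] = set0.
  by apply/setP => x; rewrite !inE; case: ltngtP.
rewrite /below -cardsUI kk0 cards0 addn0; apply: eq_card => x;
by rewrite !inE ltnS leq_eqVlt orbC.
Qed.

Lemma below_lt k : (k <= d)%N -> (below k < 2 ^ d)%N.
Proof.
move=> kd; rewrite -card_cube -cardsT; apply: proper_card.
rewrite properE subsetT; apply/subsetPn; exists [ffun=> true] => //.
rewrite inE -leqNgt; apply: leq_trans kd _.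
rewrite /level (_ : [set i | _] = setT) ?cardsT ?card_ord //.
by apply/setP => i; rewrite !inE ffunE.
Qed.

Variables (r : nat) (r0 : (0 < r)%N).

(** Levels are grouped by the fraction of the cube strictly below them: band [i] corresponds to
    fractions in [[i / r, (i + 1) / r)]. *)
Definition band k := (r * below k %/ 2 ^ d)%N.

Lemma band_lt k : (k <= d)%N -> (band k < r)%N.
Proof.
by move=> kd; rewrite ltn_divLR ?expn_gt0 // ltn_pmul2l // below_lt.
Qed.

(* Half the sum of two consecutive levels [l] and [l.+1] is the lower one. *)
Definition edge_low (e : edge Q) : nat := (\sum_(x in val e) level x)./2.

(** The default colour [Ordinal r0] is never reached, by [band_lt]. *)
Definition band_colouring : {ffun edge Q -> 'I_r} :=
  [ffun e => insubd (Ordinal r0) (band (edge_low e))].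

Lemma edge_lowP (e : edge Q) :
  exists x y : V, [/\ val e = [set x; y], level x = edge_low e
    & level y = (edge_low e).+1].
Proof.
have [x [y [exy ly]]] := edge_level e; exists x, y.
suff -> : edge_low e = level x by [].
have xy : x \notin [set y] by rewrite inE (edge_neq Q _ _ _ exy).
rewrite /edge_low exy big_setU1 // big_set1 /= ly addnS addnn.
by rewrite -[_.*2.+1]/(true + _)%N half_bit_double.
Qed.

Lemma band_colouringE e : band_colouring e = band (edge_low e) :> nat.
Proof.
rewrite ffunE val_insubd band_lt //.
by have [x [_ [_ <- _]]] := edge_lowP e; apply: level_max.
Qed.

Lemma band_colouring_forest (A : {set edge Q}) i M :
  acyclic_rel (subadj A) -> (forall k, 'C(d, k) <= M)%N ->
  (r * #|[set e in A | band_colouring e == i]| <= 2 ^ d + 2 * r * M)%N.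
Proof.
move=> acA binM; set F := [set e in A | _].
have [->|[e0 e0F]] := set_0Vmem F; first by rewrite cards0 muln0.
have FE e : e \in F -> band (edge_low e) = i /\ (edge_low e < d.+1)%N.
  rewrite inE => /andP[_ /eqP <-]; rewrite band_colouringE; split=> //.
  by have [x [_ [_ <- _]]] := edge_lowP e; apply: level_max.
have [b0 l0] := FE _ e0F; pose P (k : 'I_d.+1) := band k == i.
have Pk0 : P (Ordinal l0) by apply/eqP.
case: (arg_minnP (fun k : 'I_d.+1 => val k) Pk0) => kmin /eqP bmin hmin.
case: (arg_maxnP (fun k : 'I_d.+1 => val k) Pk0) => kmax /eqP bmax hmax.
have kk : (kmin <= kmax)%N by apply: hmin; apply/eqP.
(* The upper end of an edge lies one level above its lower end, so level [kmax.+1] is included. *)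
pose W : {set V} := [set x | kmin <= level x < kmax.+2]%N.
have FW : (#|F| <= #|W|)%N.
  apply: (card_forest_endpoints Q A F W acA); first by apply/subsetP => e /setIdP[].
  move=> e eF; have [be le] := FE _ eF; have [x [y [-> lx ly]]] := edge_lowP e.
  have Pe : P (Ordinal le) by apply/eqP.
  have := hmin _ Pe; have := hmax _ Pe => /= h1 h2.
  apply/subsetP => z /set2P[] ->; rewrite inE ?lx ?ly ?h2 ?(leqW h2) /= !ltnS //.
  exact: leqW.
have cW : (#|W| + below kmin = below kmax.+2)%N.
  have W0 : W :&: [set x | level x < kmin]%N = set0.
    by apply/setP => x; rewrite !inE; case: (leqP kmin (level x)); rewrite ?andbF.
  rewrite /below -cardsUI W0 cards0 addn0; apply: eq_card => x; rewrite !inE.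
  by case: (ltnP (level x) kmin) => h /=; rewrite ?orbF ?orbT //; lia.
have := leq_trans (card_layer kmax) (binM _).
have := leq_trans (card_layer kmax.+1) (binM _).
move: cW; rewrite !belowS; set p := #|[set x | level x == kmax]|.
set q := #|[set x | level x == kmax.+1]|.
set bM := below kmax; set bm := below kmin => cW hq hp.
(* Fewer than [2 ^ d / r] vertices lie from level [kmin] up to below [kmax]; the two top levels of
   [W] add at most [2 * M]. *)
have h1 : (r * bM < i.+1 * 2 ^ d)%N by rewrite -ltn_divLR ?expn_gt0 // -/(band _) bmax.
have h2 : (i * 2 ^ d <= r * bm)%N by rewrite -bmin leq_trunc_div.
suff : (r * #|W| + r * bm <= 2 ^ d + 2 * r * M + r * bm)%N.
  rewrite leq_add2r; apply: leq_trans; rewrite leq_mul2l FW orbT //.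
rewrite -mulnDr cW 2!mulnDr -addnA -mulnDr mulnDr.
have h3 : (r * q <= r * M)%N by rewrite leq_mul2l hq orbT.
have h4 : (r * p <= r * M)%N by rewrite leq_mul2l hp orbT.
by move: h1; rewrite mulSn -mulnA mul2n -addnn; lia.
Qed.

End CubeGraph.

(** * Vertices meeting one or several colours, and the ranks of the colour classes *)

Section LowerBound.
Import boot.fintype boot.fingraph boot.finset.
Variables (d r : nat).
Notation V := {ffun 'I_d -> bool}.
Notation Q := (hypercube d).
Variable f : {ffun edge Q -> 'I_r}.
Implicit Types (x y : V) (i : 'I_r) (j : 'I_d).

Definition colour_class i : {set edge Q} := [set e | f e == i].
Notation col i := (subadj (colour_class i)).

Definition colour_degree i x := #|[set j | col i x (flip d j x)]|.

Definition monochromatic i := [set x | [forall j, col i x (flip d j x)]].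

Definition polychromatic := [set x | [forall i, x \notin monochromatic i]].

Lemma col_inj i i' x y : col i x y -> col i' x y -> i = i'.
Proof.
case/subadjP => e; rewrite inE => /eqP <- exy.
case/subadjP => e'; rewrite inE => /eqP <- e'xy; congr (f _).
by apply: val_inj; rewrite exy.
Qed.

Lemma exists_col x j : exists i, col i x (flip d j x).
Proof.
have xjP : is_edge (G := Q) [set (x : Q); flip d j x].
  apply/existsP; exists x; apply/existsP; exists (flip d j x).
  by rewrite eqxx andbT; apply: cube_adj_flip.
pose e : edge Q := exist (fun a : {set Q} => is_edge a) _ xjP.
by exists (f e); apply/subadjP; exists e; rewrite ?inE.
Qed.

Lemma flip_inj x : injective (fun j => flip d j x).
Proof.
move=> j j' /ffunP /(_ j); rewrite !ffunE eqxx.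
by case: eqP => // _; case: (x j).
Qed.

Lemma colour_degree_lt i x : (colour_degree i x < #|connect (col i) x|)%N.
Proof.
rewrite /colour_degree -(card_imset _ (flip_inj x)).
have xN : x \notin [set flip d j x | j in [set j | col i x (flip d j x)]].
  apply/imsetP => -[j _ /ffunP/(_ j)]; rewrite ffunE eqxx.
  by case: (x j).
set N := imset _ _ in xN *; have -> : #|N|.+1 = #|x |: N| by rewrite cardsU1 xN.
apply: subset_leq_card; apply/subsetP => y /setU1P[->|/imsetP[j + ->]].
  exact: connect0.
by rewrite inE; apply: connect1.
Qed.

Lemma major_colour x : (0 < d)%N -> exists i, (d <= r * colour_degree i x)%N.
Proof.
move=> d0; apply/existsP; apply: contraT => /existsPn h.
have [i0 _] := exists_col x (Ordinal d0).
have : (\sum_(i < r) r * colour_degree i x <= \sum_(i < r) d.-1)%N.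
  by apply: leq_sum => i _; have := h i; rewrite -ltnNge; lia.
have : (d <= \sum_(i < r) colour_degree i x)%N.
  rewrite -{1}(card_ord d) -sum1_card.
  under [X in (_ <= X)%N]eq_bigr => i _ do
    rewrite /colour_degree -sum1_card big_mkcond /=.
  rewrite exchange_big /=; apply: leq_sum => j _.
  by have [i ci] := exists_col x j; rewrite (bigD1 i) //= inE ci.
rewrite -big_distrr sum_nat_const card_ord /= => h1 h2.
have := leq_trans (leq_mul (leqnn r) h1) h2.
have r0 := leq_ltn_trans (leq0n _) (ltn_ord i0).
by rewrite leq_mul2l (gtn_eqF r0) /=; lia.
Qed.

Lemma polychromatic_colour x i : (0 < d)%N -> x \in polychromatic ->
  exists2 i', i' != i & (0 < colour_degree i' x)%N.
Proof.
move=> d0; rewrite inE => /forallP /(_ i); rewrite inE => /forallPn[j nij].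
have [i' ci'] := exists_col x j; exists i'.
  by apply: contraNneq nij => <-.
by apply/card_gt0P; exists j; rewrite inE.
Qed.

(** An edge from [x] to class [i] would have two colours, [i] and the single colour of [x]. Hence
    only polychromatic vertices border a class from outside. *)
Lemma out_monochromatic i x :
  x \notin monochromatic i -> x \notin polychromatic ->
  out_degree d d (~: monochromatic i) x = 0%N.
Proof.
move=> xi; rewrite inE => /forallPn[i']; rewrite negbK => xi'.
apply/eqP; rewrite cards_eq0; apply/eqP/setP => j; rewrite !inE ltn_ord /= negbK.
apply/negP => /forallP /(_ j); rewrite flipK subadj_sym => c1.
move: (xi'); rewrite inE => /forallP /(_ j) c2.
by rewrite (col_inj _ _ _ _ c1 c2) xi' in xi.
Qed.

Variable R : realType.

Local Notation weight i x := (1 - (#|connect (col i) x|%:R)^-1 : R).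

Lemma weight_ge i x (k : nat) : (0 < k)%N -> (k <= #|connect (col i) x|)%N ->
  1 - k%:R^-1 <= weight i x.
Proof.
move=> k0 kC; rewrite lerD2l lerN2 lef_pV2 ?posrE ?ltr0n ?ler_nat //.
exact: leq_trans kC.
Qed.

Lemma card_connect_gt0 i x : (0 < #|connect (col i) x|)%N.
Proof. exact: leq_ltn_trans (colour_degree_lt i x). Qed.

Lemma weight_ge0 i x : 0 <= weight i x.
Proof.
apply: le_trans (weight_ge i x 1 isT (card_connect_gt0 i x)).
by rewrite invr1 subrr.
Qed.

(** The major colour has a component of more than [d / r] vertices. At a polychromatic vertex a
    different colour has a component of at least two vertices and adds the [1 / 2]. *)
Lemma sum_weight_ge x : (0 < d)%N ->
  1 - r%:R / d%:R + (x \in polychromatic)%:R / 2 <= \sum_i weight i x.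
Proof.
move=> d0; have [i di] := major_colour x d0; rewrite (bigD1 i) //=.
have dR : 0 < d%:R :> R by rewrite ltr0n.
apply: lerD.
  rewrite lerD2l lerN2 -lef_pV2 ?posrE ?invr_gt0 ?ltr0n ?card_connect_gt0 //.
    rewrite invrK invf_div ler_pdivrMr ?ltr0n; last first.
      by rewrite (leq_ltn_trans _ (ltn_ord i)).
    rewrite -natrM ler_nat mulnC (leq_trans di) // leq_mul2l ltnW ?orbT //.
    exact: colour_degree_lt.
  by rewrite divr_gt0 // ltr0n (leq_ltn_trans _ (ltn_ord i)).
have [xp|_] := boolP (x \in polychromatic); last first.
  by rewrite mul0r sumr_ge0 // => i' _; apply: weight_ge0.
have [i' i'i di'] := polychromatic_colour x i d0 xp; rewrite (bigD1 i') //=.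
rewrite mul1r -[X in X <= _]addr0 lerD //; last first.
  by rewrite sumr_ge0 // => i'' _; apply: weight_ge0.
apply: le_trans (weight_ge i' x 2 isT _); first by lra.
by apply: leq_trans (colour_degree_lt i' x).
Qed.

Lemma rank_weight i : (2 ^ d)%:R - (comps Q (colour_class i))%:R =
  \sum_x weight i x :> R.
Proof. by rewrite compsE sumrB sumr_const /= -card_cube. Qed.

Section Bound.
Variable K : R.
Hypothesis rankK : forall i, (2 ^ d)%:R - (comps Q (colour_class i))%:R <= K.
Hypothesis d_gt0 : (0 < d)%N.

(** Sum [sum_weight_ge] over the vertices and exchange the sums. When [r * K] is [n + D - 1], the
    main terms cancel and [#|polychromatic|] is at most [2 * D + 2 * n * r / d]. *)
Lemma card_polychromatic_le :
  (2 ^ d)%:R * (1 - r%:R / d%:R) + #|polychromatic|%:R / 2 <= r%:R * K.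
Proof.
have -> : r%:R * K = \sum_(i < r) K by rewrite sumr_const card_ord mulr_natl.
apply: le_trans (ler_sum _ (fun i _ => rankK i)).
under eq_bigr do rewrite rank_weight; rewrite exchange_big /=.
apply: le_trans (ler_sum _ (fun x _ => sum_weight_ge x d_gt0)).
rewrite big_split /= sumr_const mulr_natl -mulr_suml -card_cube.
have -> : \sum_x (x \in polychromatic)%:R = #|polychromatic|%:R :> R.
  by rewrite -natr_sum -sum1_card [in RHS]big_mkcond.
exact: lexx.
Qed.

(** The component of a monochromatic vertex contains it and its [d] neighbours. *)
Lemma card_monochromatic_le i :
  #|monochromatic i|%:R * (1 - d.+1%:R^-1) <= K.
Proof.
apply: le_trans (rankK i); rewrite rank_weight.
rewrite (bigID (mem (monochromatic i))) /= -[X in X <= _]addr0 lerD //; last first.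
  by rewrite sumr_ge0 // => x _; apply: weight_ge0.
rewrite mulr_natl -sumr_const; apply: ler_sum => x; rewrite inE => /forallP xi.
apply: weight_ge => //; apply: leq_trans (colour_degree_lt i x).
rewrite ltnS -[d in (d <= _)%N]card_ord -cardsT; apply: subset_leq_card.
by apply/subsetP => j _; rewrite inE.
Qed.

End Bound.

Lemma large_monochromatic : (0 < r)%N -> exists i,
  (2 ^ d <= r * #|monochromatic i| + #|polychromatic|)%N.
Proof.
move=> r0; apply/existsP; apply: contraT => /existsPn h.
have h1 : (2 ^ d <= \sum_(i < r) #|monochromatic i| + #|polychromatic|)%N.
  rewrite -card_cube -[X in (X <= _)%N]sum1_card -[X in (_ <= _ + X)%N]sum1_card.
  under [X in (_ <= X + _)%N]eq_bigr => i _ do rewrite -sum1_card big_mkcond /=.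
  rewrite [X in (_ <= _ + X)%N]big_mkcond exchange_big -big_split /=.
  apply: leq_sum => x _; have [|] := boolP (x \in polychromatic).
    by rewrite addn1.
  rewrite inE => /forallPn[i]; rewrite negbK => xi.
  by rewrite (bigD1 i) //= xi.
have : (\sum_(i < r) (r * #|monochromatic i| + #|polychromatic|).+1 <=
    \sum_(i < r) 2 ^ d)%N.
  by apply: leq_sum => i _; have := h i; rewrite -ltnNge.
under eq_bigr do rewrite -addnS.
rewrite big_split -big_distrr !sum_nat_const card_ord /= -mulnDr leq_mul2l.
by rewrite eqn0Ngt r0 addnS ltnNge h1.
Qed.

(** Isoperimetry is applied to the complement of the class, so that the vertices with nonzero
    out-degree are polychromatic; each out-degree is at most [d]. *)
Lemma polychromatic_separates i :
  #|monochromatic i|%:R * ((2 ^ d)%:R - #|monochromatic i|%:R) / (2 * (2 ^ d)%:R)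
   <= #|polychromatic|%:R * Num.sqrt d%:R :> R.
Proof.
have := cube_isoperimetry d R (~: monochromatic i).
have -> : #|~: monochromatic i|%:R = (2 ^ d)%:R - #|monochromatic i|%:R :> R.
  by rewrite -card_cube -(cardsC (monochromatic i)) natrD addrAC subrr add0r.
rewrite -natrX subKr [X in X / _]mulrC => h; apply: le_trans h _.
rewrite mulr_natl -sumr_const big_mkcond [X in _ <= X]big_mkcond /=.
apply: ler_sum => x _; rewrite inE; have [xi|xi] := boolP (x \in monochromatic i).
  by case: ifP => // _; rewrite sqrtr_ge0.
have [xp|xp] /= := boolP (x \in polychromatic); last first.
  by rewrite out_monochromatic // sqrtr0.
rewrite ler_sqrt // ler_nat /out_degree -[X in (_ <= X)%N]card_ord -cardsT.
exact/subset_leq_card/subsetT.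
Qed.

End LowerBound.

(** * Attaching the supremum and infimum to trees and ranks *)

Section Extrema.
Import boot.fintype boot.finset.
Variables (R : realType) (r : nat) (G : sgraph).
Hypothesis r_gt0 : (0 < r)%N.
Hypothesis G_connected : connected_rel (@adj G).
Implicit Types (f : {ffun edge G -> 'I_r}) (A : {set edge G}).

Lemma tree_discE f A : tree_disc R f A =
  r%:R * (\max_(i < r) #|[set a in A | f a == i]|)%N%:R - (#|G|%:R - 1).
Proof.
rewrite /tree_disc mulrBr; congr (_ - _).
by rewrite mulrC divfK // pnatr_eq0 -lt0n.
Qed.

Lemma tree_disc_le f A : spanning_tree A -> tree_disc R f A <= colouring_disc R f.
Proof.
move=> stA; apply: ub_le_sup; last by exists A.
exists (r%:R * #|{: edge G}|%:R - (#|G|%:R - 1)) => _ [B _ <-].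
rewrite tree_discE lerD2r ler_wpM2l // ler_nat; apply/bigmax_leqP => i _.
exact: max_card.
Qed.

Lemma colouring_disc_le f (b : R) :
  (forall A, spanning_tree A -> tree_disc R f A <= b) -> colouring_disc R f <= b.
Proof.
move=> fb; apply: ge_sup => [|_ [A stA <-]]; last exact: fb.
by have [A stA _] := exists_spanning_tree G set0 G_connected;
  exists (tree_disc R f A), A.
Qed.

(** Some spanning tree contains a maximal forest of colour [i], hence at least [#|G| - comps] edges
    of that colour. *)
Lemma rank_le_disc f i :
  #|G|%:R - (comps G [set e | f e == i])%:R <=
  (#|G|%:R - 1 + colouring_disc R f) / r%:R.
Proof.
have [A stA hA] := exists_spanning_tree G [set e | f e == i] G_connected.
have := tree_disc_le f A stA; rewrite tree_discE => h.
rewrite ler_pdivlMr ?ltr0n // mulrC -lerBlDl; apply: le_trans h.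
rewrite lerD2r ler_wpM2l // lerBlDr -natrD ler_nat (leq_trans hA) // leq_add2r.
apply: leq_trans (leq_bigmax i); apply: subset_leq_card.
by apply/subsetP => e; rewrite !inE.
Qed.

Lemma spanning_tree_disc_ge (b : R) :
  (forall f, b <= colouring_disc R f) -> b <= spanning_tree_disc R r G.
Proof.
move=> bf; apply: lb_le_inf => [|_ [f _ <-]]; last exact: bf.
pose f : {ffun edge G -> 'I_r} := [ffun=> Ordinal r_gt0].
by exists (colouring_disc R f), f.
Qed.

Lemma spanning_tree_disc_le f : spanning_tree_disc R r G <= colouring_disc R f.
Proof.
apply: ge_inf; last by exists f.
(* The infimum needs a lower bound; this one follows from [rank_le_disc], since ranks are
   nonnegative. *)
exists (1 - #|G|%:R) => _ [g _ <-].
have := rank_le_disc g (Ordinal r_gt0); rewrite ler_pdivlMr ?ltr0n // => h.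
suff : 0 <= #|G|%:R - (comps G [set e | g e == Ordinal r_gt0])%:R :> R.
  by rewrite -(pmulr_lge0 _ (_ : 0 < r%:R :> R)) ?ltr0n // => /le_trans/(_ h); lra.
by rewrite subr_ge0 ler_nat max_card.
Qed.

End Extrema.

(** * The two explicit bounds for the cube and the asymptotic statement *)

Section HypercubeBounds.
Variables (R : realType) (r : nat).
Hypothesis r_ge2 : (2 <= r)%N.

Let r_gt0 : (0 < r)%N. Proof. exact: ltnW. Qed.

Lemma spanning_tree_disc_cube_le d : (0 < d)%N ->
  spanning_tree_disc R r (hypercube d) <= (2 * r + 1)%:R * (2 ^+ d / Num.sqrt d%:R).
Proof.
move=> d0; have conn := @cube_connected d.
apply: le_trans (spanning_tree_disc_le R r _ r_gt0 conn (band_colouring d r r_gt0)) _.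
apply: colouring_disc_le => // A [_ acA]; rewrite tree_discE // card_cube.
set m := (\max_(i < r) _)%N; pose M := (\max_(k < d.+1) 'C(d, k))%N.
have sd : 0 < Num.sqrt d%:R :> R by rewrite sqrtr_gt0 ltr0n.
have binM k : ('C(d, k) <= M)%N.
  have [kd|kd] := leqP k d; last by rewrite bin_small.
  exact: (@bigop.leq_bigmax _ (fun k : 'I_d.+1 => 'C(d, k)) (Ordinal (kd : (k < d.+1)%N))).
have : (r * m <= 2 ^ d + 2 * r * M)%N.
  rewrite mulnC -leq_divRL //; apply/bigmax_leqP => i _.
  by rewrite leq_divRL // mulnC; apply: band_colouring_forest.
rewrite -(ler_nat R) natrD !natrM natrX => hm.
have hM : M%:R <= 2 ^+ d / Num.sqrt d%:R :> R.
  rewrite /M; have [|k ->] := @bigop.eq_bigmax _ (fun k : 'I_d.+1 => 'C(d, k)).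
    by rewrite card_ord.
  by rewrite ler_pdivlMr // bin_sqrt_le.
(* The discrepancy is at most [2 * r * M + 1]; this absorbs the [1] and gives the constant
   [2 * r + 1]. *)
have h1 : 1 <= 2 ^+ d / Num.sqrt d%:R :> R.
  by rewrite ler_pdivlMr // mul1r; have := bin_sqrt_le R d 0; rewrite bin0 mul1r.
rewrite natrD natrM.
have := ler_wpM2l (_ : 0 <= 2 * r%:R :> R) hM; rewrite mulr_ge0 // => /(_ isT).
move: hm h1; set q := _ / _; lra.
Qed.

(* Here [rho = 1/r], [sig = 1/sqrt d], and [dl], [b], [mu] are the discrepancy,
   the number of polychromatic vertices and the size of the largest
   monochromatic class, all divided by [2^d]. *)
Lemma discrepancy_arith (rho sig dl b mu : R) :
  0 < rho -> rho <= 2^-1 -> 0 < sig -> sig <= rho ^+ 2 / 128 ->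
  b <= 2 * dl + 2 * sig ^+ 2 / rho ->
  rho * (1 - b) <= mu ->
  mu * (1 - sig ^+ 2) <= rho * (1 + dl) ->
  sig * (mu * (1 - mu) / 2) <= b ->
  rho * sig / 64 <= dl.
Proof.
move=> rho0 rho2 sig0 sigr hb mub mul hmu.
rewrite leNgt; apply/negP => hdl.
have rs0 : 0 < rho * sig by rewrite mulr_gt0.
have rr : rho ^+ 2 <= 4^-1 by nra.
have sig1 : sig <= 512^-1 by lra.
have rs : rho * sig <= 1024^-1 by nra.
have b1 : 2 * sig ^+ 2 / rho <= rho * sig / 64.
  rewrite ler_pdivrMr //.
  have -> : rho * sig / 64 * rho = 2 * sig * (rho ^+ 2 / 128) by field.
  have -> : 2 * sig ^+ 2 = 2 * sig * sig by ring.
  by rewrite ler_wpM2l // mulr_ge0 // ltW.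
have b2 : b <= 3 * (rho * sig) / 64 by lra.
have b3 : b <= 2^-1 by lra.
have mu1 : rho / 2 <= mu by nra.
have s2 : sig ^+ 2 <= 100^-1 by nra.
have mu2 : mu <= 3 / 4.
  have : rho * (1 + dl) <= 65 / 128 by nra.
  by nra.
have mu3 : rho / 16 <= mu * (1 - mu) / 2 by nra.
have : sig * (rho / 16) <= b.
  by apply: le_trans hmu; rewrite ler_wpM2l // ltW.
lra.
Qed.

(** The threshold on [d] is the hypothesis [sig <= rho ^+ 2 / 128] of [discrepancy_arith], inverted
    and squared. *)
Lemma spanning_tree_disc_cube_ge d : (128 ^ 2 * r ^ 4 <= d)%N ->
  (64 * r)%:R^-1 * (2 ^+ d / Num.sqrt d%:R) <= spanning_tree_disc R r (hypercube d).
Proof.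
move=> dr; have conn := @cube_connected d.
have d0 : (0 < d)%N.
  by apply: leq_trans dr; rewrite muln_gt0 !expn_gt0 r_gt0.
apply: spanning_tree_disc_ge => // f; set D := colouring_disc R f.
set n : R := 2 ^+ d; set s := Num.sqrt d%:R.
have n0 : 0 < n by rewrite exprn_gt0.
have s0 : 0 < s by rewrite sqrtr_gt0 ltr0n.
have s2 : s ^+ 2 = d%:R by rewrite sqr_sqrtr.
have rR : 2 <= r%:R :> R by rewrite ler_nat.
have nE : (2 ^ d)%:R = n by rewrite natrX.
pose K := (n - 1 + D) / r%:R.
have rK i : (2 ^ d)%:R - (comps _ (colour_class d r f i))%:R <= K.
  by have := rank_le_disc R r _ r_gt0 conn f i; rewrite card_cube nE.
have [i hi] := large_monochromatic d r f r_gt0.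
have := card_polychromatic_le d r f R K rK d0.
have := card_monochromatic_le d r f R K rK i.
have := polychromatic_separates d r f R i.
move: hi; rewrite -(ler_nat R) natrD natrM nE -/s.
set m : R := (#|monochromatic d r f i|)%:R; set b : R := (#|polychromatic d r f|)%:R.
have m0 : 0 <= m by [].
have b0 : 0 <= b by [].
move=> h1 h2 h3 h4.
have rn0 : r%:R != 0 :> R by rewrite gt_eqF // ltr0n.
have sn0 : s != 0 by rewrite gt_eqF.
have nn0 : n != 0 by rewrite gt_eqF.
have : r%:R^-1 * s^-1 / 64 <= D / n.
  apply: (discrepancy_arith _ _ _ (b / n) (m / n)).
  - by rewrite invr_gt0 ltr0n.
  - by rewrite lef_pV2 ?posrE // ltr0n.
  - by rewrite invr_gt0.
  - have -> : r%:R^-1 ^+ 2 / 128 = (128 * r%:R ^+ 2)^-1 :> R by field.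
    rewrite lef_pV2 ?posrE ?mulr_gt0 ?exprn_gt0 ?ltr0n //.
    rewrite -(@ler_pXn2r _ 2%N) ?nnegrE ?mulr_ge0 ?exprn_ge0 ?(ltW s0) //.
    by rewrite s2 exprMn -exprM -!natrX -natrM ler_nat.
  - have -> : 2 * s^-1 ^+ 2 / r%:R^-1 = 2 * r%:R / d%:R by rewrite -s2; field; rewrite rn0 sn0.
    have -> : 2 * (D / n) + 2 * r%:R / d%:R = (2 * D + 2 * n * (r%:R / d%:R)) / n.
      by field; rewrite nn0 pnatr_eq0 -lt0n.
    rewrite ler_pM2r ?invr_gt0 //.
    have KE : r%:R * K = n - 1 + D by rewrite /K; field.
    rewrite KE in h4; lra.
  - rewrite ler_pdivlMr //.
    have -> : r%:R^-1 * (1 - b / n) * n = (n - b) / r%:R by field; rewrite ?rn0 ?nn0.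
    by rewrite ler_pdivrMr ?ltr0n // mulrC lerBlDr.
  - have : s^-1 ^+ 2 = d%:R^-1 by rewrite exprVn s2.
    move=> ->; rewrite mulrAC ler_pdivrMr //.
    have -> : r%:R^-1 * (1 + D / n) * n = (n + D) / r%:R by field; rewrite ?rn0 ?nn0.
    (* Weakening [1 / (d + 1)] to [1 / d] lets the bound be written with [sig ^+ 2]. *)
    have h5 : m * (1 - d%:R^-1) <= m * (1 - d.+1%:R^-1).
      by rewrite ler_wpM2l // lerD2l lerN2 lef_pV2 ?posrE ?ltr0n // ler_nat.
    apply: le_trans h5 (le_trans h3 _); rewrite /K ler_wpM2r ?invr_ge0 //; lra.
  - rewrite mulrC ler_pdivrMr // [_ / n * s]mulrAC ler_pdivlMr //.
    apply: le_trans h2; rewrite le_eqVlt; apply/orP; left; apply/eqP.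
    by field; rewrite ?rn0 ?nn0.
rewrite ler_pdivlMr // => h; apply: le_trans h; rewrite natrM.
rewrite le_eqVlt; apply/orP; left; apply/eqP; field.
by rewrite rn0 sn0.
Qed.

End HypercubeBounds.

Theorem corollary1p8 (R : realType) (r : nat) (hr : (2 <= r)%N) :
  (fun d : nat => spanning_tree_disc R r (hypercube d))
    \is 'Theta_\oo (fun d : nat =>
          let n : R := (2 ^ d)%:R in n / Num.sqrt (ln n)).
Proof.
have ln2 : 0 < ln (2 : R) by rewrite ln_gt0 // ltr1n.
set L := Num.sqrt (ln (2 : R)); have L0 : 0 < L by rewrite sqrtr_gt0.
(* Since [ln n = d * ln 2], the two rates differ by the constant factor [L]. *)
have rate d : (0 < d)%N -> 2 ^+ d / Num.sqrt d%:R =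
    L * (let n : R := (2 ^ d)%:R in n / Num.sqrt (ln n)).
  move=> d0; have sd : 0 < Num.sqrt d%:R :> R by rewrite sqrtr_gt0 ltr0n.
  rewrite /= natrX lnXn // -[ln _ *+ d]mulr_natl sqrtrM // -/L; field.
  by rewrite !gt_eqF.
apply/asboolP; exists ((64 * r)%:R^-1 * L, (2 * r + 1)%:R * L) => /=.
  by apply/andP; split; rewrite mulr_gt0 ?invr_gt0 ?ltr0n ?muln_gt0 ?addn1 ?(ltnW hr).
near=> d.
have dr : (128 ^ 2 * r ^ 4 <= d)%N by near: d; exact: nbhs_infty_ge.
have d0 : (0 < d)%N.
  by apply: leq_trans dr; rewrite muln_gt0 !expn_gt0 (ltnW hr).
have h1 := spanning_tree_disc_cube_ge R r hr d dr.
have h2 := spanning_tree_disc_cube_le R r hr d d0.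
(* The Theta relation compares norms, so signs are needed to remove them. *)
have g0 : 0 <= (2 ^ d)%:R / Num.sqrt (ln (2 ^ d)%:R) :> R.
  by rewrite divr_ge0 ?sqrtr_ge0.
have q0 : 0 <= 2 ^+ d / Num.sqrt d%:R :> R.
  by rewrite divr_ge0 ?sqrtr_ge0 ?exprn_ge0.
have D0 : 0 <= spanning_tree_disc R r (hypercube d).
  by apply: le_trans h1; rewrite mulr_ge0 ?invr_ge0.
rewrite !ger0_norm // -!mulrA -(rate d d0); split; [exact: h1|exact: h2].
Unshelve. all: by end_near.
Qed.
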